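(* Let $\mathbb{K}$ be an algebraically closed field of characteristic zero and let $H$ be a Hopf algebra over $\mathbb{K}$ with antipode $\mathcal{S}$ such that $\mathcal{S}^2$ has finite odd order. Then $H$ is almost involutive.
   Context: A Hopf algebra $H$ with antipode $\mathcal{S}$ is almost involutive if there exists a Hopf algebra automorphism $\sigma:H\to H$ such that $\sigma^2=\mathcal{S}^2$. The order of $\mathcal{S}^2$ is its order under composition, i.e. the least $m\ge 1$ with $(\mathcal{S}^2)^m=\mathrm{id}$. *)

(* Defs.v *)
From HB Require Import structures.
From mathcomp Require Import all_boot all_order all_algebra.
From mathcomp Require Import boolp.

Set Implicit Arguments.
Unset Strict Implicit.
Unset Printing Implicit Defensive.

Import GRing.Theory.
Local Open Scope ring_scope.
Local Open Scope quotient_scope.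

(* The tensor product of two vector spaces, of arbitrary dimension.  The list
   [:: (u1, v1); ...; (un, vn)] stands for the formal sum of the ui (x) vi, and
   [tens_rel] is the congruence generated by the bilinearity relations.  Scalars
   are carried by the first component, so [a *: (u, v)] is [(a *: u, v)]. *)
Section Tensor.
Variables (K : fieldType) (U V : lmodType K).

Inductive tens_rel : seq (U * V) -> seq (U * V) -> Prop :=
| tens_rel_refl s : tens_rel s s
| tens_rel_sym s t : tens_rel s t -> tens_rel t s
| tens_rel_trans s t r : tens_rel s t -> tens_rel t r -> tens_rel s r
| tens_rel_cat s s' t t' :
    tens_rel s s' -> tens_rel t t' -> tens_rel (s ++ t) (s' ++ t')
| tens_rel_catC s t : tens_rel (s ++ t) (t ++ s)
| tens_rel_0 v : tens_rel [:: (0, v)] [::]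
| tens_rel_Dl u u' v : tens_rel [:: (u + u', v)] [:: (u, v); (u', v)]
| tens_rel_Dr u v v' : tens_rel [:: (u, v + v')] [:: (u, v); (u, v')]
| tens_rel_Z a u v : tens_rel [:: (a *: u, v)] [:: (u, a *: v)].

Definition tens_relb (s t : seq (U * V)) : bool := `[< tens_rel s t >].

Lemma tens_relb_refl : reflexive tens_relb.
Proof. by move=> s; apply/asboolP; exact: tens_rel_refl. Qed.

Lemma tens_relb_sym : symmetric tens_relb.
Proof. by move=> s t; apply/asboolP/asboolP => h; exact: tens_rel_sym. Qed.

Lemma tens_relb_trans : transitive tens_relb.
Proof.
by move=> t s r /asboolP h /asboolP h'; apply/asboolP; exact: tens_rel_trans h h'.
Qed.

Canonical tens_equiv :=
  EquivRel tens_relb tens_relb_refl tens_relb_sym tens_relb_trans.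

Definition tensor : Type := {eq_quot tens_equiv}.
HB.instance Definition _ := Choice.on tensor.
HB.instance Definition _ := EqQuotient.on tensor.

Definition tens_class (s : seq (U * V)) : tensor := \pi s.

Definition tens (u : U) (v : V) : tensor := tens_class [:: (u, v)].

Definition tens_zero : tensor := tens_class [::].
Definition tens_add (x y : tensor) : tensor := tens_class (repr x ++ repr y).
Definition tens_scale (a : K) (x : tensor) : tensor :=
  tens_class [seq (a *: p.1, p.2) | p <- repr x].
Definition tens_opp (x : tensor) : tensor := tens_scale (-1) x.

Lemma tens_piP s t : tens_class s = tens_class t <-> tens_rel s t.
Proof.
split=> [|h]; first by move=> /eqquotP /asboolP.
by apply/eqquotP/asboolP.
Qed.

Lemma tens_classK (x : tensor) : tens_class (repr x) = x.
Proof. exact: reprK. Qed.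

Lemma tens_classW (P : tensor -> Prop) :
  (forall s, P (tens_class s)) -> forall x, P x.
Proof. by move=> Pc x; rewrite -[x]tens_classK. Qed.

Lemma tens_rel_repr s : tens_rel (repr (tens_class s)) s.
Proof. by apply/tens_piP; rewrite tens_classK. Qed.

Lemma tens_rel_scale a s t : tens_rel s t ->
  tens_rel [seq (a *: p.1, p.2) | p <- s] [seq (a *: p.1, p.2) | p <- t].
Proof.
elim=> {s t} /=.
- by move=> s; exact: tens_rel_refl.
- by move=> s t _; exact: tens_rel_sym.
- by move=> s t r _ h _; exact: tens_rel_trans.
- by move=> s s' t t' _ h _ h'; rewrite !map_cat; exact: tens_rel_cat.
- by move=> s t; rewrite !map_cat; exact: tens_rel_catC.
- by move=> v; rewrite scaler0; exact: tens_rel_0.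
- by move=> u u' v; rewrite scalerDr; exact: tens_rel_Dl.
- by move=> u v v'; exact: tens_rel_Dr.
- by move=> b u v; rewrite scalerA mulrC -scalerA; exact: tens_rel_Z.
Qed.

Lemma tens_addE s t :
  tens_add (tens_class s) (tens_class t) = tens_class (s ++ t).
Proof. by apply/tens_piP/tens_rel_cat; exact: tens_rel_repr. Qed.

Lemma tens_scaleE a s :
  tens_scale a (tens_class s) = tens_class [seq (a *: p.1, p.2) | p <- s].
Proof. by apply/tens_piP/tens_rel_scale; exact: tens_rel_repr. Qed.

Lemma tens_addA : associative tens_add.
Proof.
elim/tens_classW=> s; elim/tens_classW=> t; elim/tens_classW=> r.
by rewrite !tens_addE catA.
Qed.

Lemma tens_addC : commutative tens_add.
Proof. by move=> x y; apply/tens_piP; exact: tens_rel_catC. Qed.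

Lemma tens_add0 : left_id tens_zero tens_add.
Proof. by elim/tens_classW=> s; rewrite tens_addE. Qed.

Lemma tens_scaleDl x a b :
  tens_scale (a + b) x = tens_add (tens_scale a x) (tens_scale b x).
Proof.
elim/tens_classW: x => s; rewrite !tens_scaleE tens_addE; apply/tens_piP.
elim: s => [|[u v] s IHs] /=; first exact: tens_rel_refl.
rewrite -cat1s scalerDl; apply: tens_rel_trans.
  exact: tens_rel_cat (tens_rel_Dl _ _ _) IHs.
rewrite -[X in tens_rel _ X]cat1s -[[:: (a *: u, v); _]]cat1s -catA.
apply: tens_rel_cat; first exact: tens_rel_refl.
rewrite -[X in tens_rel _ (_ ++ X)]cat1s !catA.
by apply: tens_rel_cat; [exact: tens_rel_catC | exact: tens_rel_refl].
Qed.

Lemma tens_scaleA a b x : tens_scale a (tens_scale b x) = tens_scale (a * b) x.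
Proof.
elim/tens_classW: x => s; rewrite !tens_scaleE -map_comp; congr tens_class.
by apply: eq_map => p /=; rewrite scalerA.
Qed.

Lemma tens_scale1 : left_id 1 tens_scale.
Proof.
elim/tens_classW=> s; rewrite tens_scaleE; congr tens_class.
by rewrite -[RHS]map_id; apply: eq_map => -[u v] /=; rewrite scale1r.
Qed.

Lemma tens_scaleDr : right_distributive tens_scale tens_add.
Proof.
move=> a; elim/tens_classW=> s; elim/tens_classW=> t.
by rewrite tens_addE !tens_scaleE tens_addE map_cat.
Qed.

Lemma tens_scale0 x : tens_scale 0 x = tens_zero.
Proof.
elim/tens_classW: x => s; rewrite tens_scaleE; apply/tens_piP.
elim: s => [|[u v] s IHs] /=; first exact: tens_rel_refl.
by rewrite scale0r -cat1s; exact: tens_rel_cat (tens_rel_0 _) IHs.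
Qed.

Lemma tens_addN : left_inverse tens_zero tens_opp tens_add.
Proof.
by move=> x; rewrite -{2}[x]tens_scale1 -tens_scaleDl addNr tens_scale0.
Qed.

HB.instance Definition _ :=
  GRing.isZmodule.Build tensor tens_addA tens_addC tens_add0 tens_addN.
HB.instance Definition _ := GRing.Zmodule_isLmodule.Build K tensor
  tens_scaleA tens_scale1 tens_scaleDr (fun x a b => tens_scaleDl x a b).

End Tensor.

Notation "u ⊗ v" := (tens u v) (at level 40, left associativity) : ring_scope.

(* The map induced on [tensor U V] by a bilinear [f].  It is defined for every
   [f], by evaluation at a chosen representative, but only meaningful when [f]
   is bilinear; the lemmas below state the universal property. *)
Definition tlift (K : fieldType) (U V W : lmodType K) (f : U -> V -> W)
    (x : tensor U V) : W :=
  \sum_(p <- repr x) f p.1 p.2.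

Section TensorTheory.
Variables (K : fieldType) (U V W : lmodType K).
Implicit Types (f : U -> V -> W) (x : tensor U V).

Lemma tens_bilinear : bilinear_for *:%R *:%R (@tens K U V).
Proof.
have scl a u v : (a *: u) ⊗ v = a *: (u ⊗ v) by rewrite [RHS]tens_scaleE.
split=> [v|u] a y z /=.
  by rewrite -scl; apply/esym; rewrite [LHS]tens_addE; apply/tens_piP/tens_rel_sym/tens_rel_Dl.
rewrite -scl; have -> : (a *: u) ⊗ y = u ⊗ (a *: y) by apply/tens_piP/tens_rel_Z.
by apply/esym; rewrite [LHS]tens_addE; apply/tens_piP/tens_rel_sym/tens_rel_Dr.
Qed.

Lemma tlift_pi f s : bilinear_for *:%R *:%R f ->
  tlift f (tens_class s) = \sum_(p <- s) f p.1 p.2.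
Proof.
move=> [fl fr]; rewrite /tlift.
have fDl u u' v : f (u + u') v = f u v + f u' v.
  by have := fl v 1 u u'; rewrite /= !scale1r.
have f0l v : f 0 v = 0 by apply: (addrI (f 0 v)); rewrite -fDl !addr0.
have fZl a u v : f (a *: u) v = a *: f u v.
  by have := fl v a u 0; rewrite /= !addr0 f0l addr0.
have fDr u v v' : f u (v + v') = f u v + f u v'.
  by have := fr u 1 v v'; rewrite /= !scale1r.
have f0r u : f u 0 = 0 by apply: (addrI (f u 0)); rewrite -fDr !addr0.
have fZr a u v : f u (a *: v) = a *: f u v.
  by have := fr u a v 0; rewrite /= !addr0 f0r addr0.
have frel s1 s2 : tens_rel s1 s2 ->
    \sum_(p <- s1) f p.1 p.2 = \sum_(p <- s2) f p.1 p.2; last first.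
  exact: frel (tens_rel_repr s).
elim=> {s s1 s2} //=.
- by move=> s1 s2 s3 _ -> _ ->.
- by move=> s s' t t' _ h _ h'; rewrite !big_cat /= h h'.
- by move=> s t; rewrite !big_cat /= addrC.
- by move=> v; rewrite big_seq1 big_nil f0l.
- by move=> u u' v; rewrite !big_cons big_nil !addr0 fDl.
- by move=> u v v'; rewrite !big_cons big_nil !addr0 fDr.
- by move=> a u v; rewrite !big_seq1 fZl fZr.
Qed.

Lemma tlift_linear f : bilinear_for *:%R *:%R f -> linear (tlift f).
Proof.
move=> hf a; elim/tens_classW=> s; elim/tens_classW=> t.
rewrite [X in tlift f (X + _)]tens_scaleE [X in tlift f X]tens_addE.
rewrite !tlift_pi // big_cat big_map /=; congr (_ + _); rewrite scaler_sumr.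
apply: eq_bigr => p _; have [fl _] := hf.
have f0 : f 0 p.2 = 0.
  by have := fl p.2 (-1) 0 0; rewrite /= !scaleN1r oppr0 addr0 addNr.
by have := fl p.2 a p.1 0; rewrite /= !addr0 f0 addr0.
Qed.

Lemma tlift_tens f u v : bilinear_for *:%R *:%R f -> tlift f (u ⊗ v) = f u v.
Proof. by move=> hf; rewrite tlift_pi // big_seq1. Qed.

Lemma tlift_unique f (g : {linear tensor U V -> W}) :
  (forall u v, g (u ⊗ v) = f u v) -> g =1 tlift f.
Proof.
move=> gf x; rewrite /tlift -{1}[x]tens_classK.
elim: (repr x) => [|[u v] s IHs]; first by rewrite big_nil [LHS]raddf0.
rewrite big_cons -IHs -gf -raddfD; congr (g _).
by apply/esym; exact: tens_addE.
Qed.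

End TensorTheory.

Definition tmap (K : fieldType) (U V U' V' : lmodType K)
    (f : U -> U') (g : V -> V') : tensor U V -> tensor U' V' :=
  tlift (fun u v => f u ⊗ g v).

Definition tassoc (K : fieldType) (U V W : lmodType K) :
    tensor (tensor U V) W -> tensor U (tensor V W) :=
  tlift (fun x w => tlift (fun u v => u ⊗ (v ⊗ w)) x).

(* The product of the algebra A (x) A: (a (x) b) (c (x) d) = ac (x) bd. *)
Definition tmul (K : fieldType) (A : algType K) (x y : tensor A A) :
    tensor A A :=
  tlift (fun a b => tlift (fun c d => (a * c) ⊗ (b * d)) y) x.

Lemma tens_linear_comp (K : fieldType) (U V U' V' : lmodType K)
    (f : {linear U -> U'}) (g : {linear V -> V'}) :
  bilinear_for *:%R *:%R (fun u v => f u ⊗ g v).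
Proof.
have [tl tr] := @tens_bilinear K U' V'.
by split=> [v|u] a x y /=; rewrite linearP; [exact: (tl (g v)) | exact: tr].
Qed.

Lemma tmap_tens (K : fieldType) (U V U' V' : lmodType K)
    (f : {linear U -> U'}) (g : {linear V -> V'}) u v :
  tmap f g (u ⊗ v) = f u ⊗ g v.
Proof. by rewrite /tmap tlift_tens //; exact: tens_linear_comp. Qed.

Lemma tlift_linear_param (K : fieldType) (U V W : lmodType K)
    (f1 f2 f3 : U -> V -> W) a (x : tensor U V) :
  (forall u v, f3 u v = a *: f1 u v + f2 u v) ->
  tlift f3 x = a *: tlift f1 x + tlift f2 x.
Proof.
move=> f3E; rewrite /tlift scaler_sumr -big_split /=.
by apply: eq_bigr => p _.
Qed.

Lemma tassoc_tens (K : fieldType) (U V W : lmodType K)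
    (u : U) (v : V) (w : W) : tassoc ((u ⊗ v) ⊗ w) = u ⊗ (v ⊗ w).
Proof.
have [tl tr] := @tens_bilinear K U (tensor V W).
have [tl' tr'] := @tens_bilinear K V W.
have bil (z : W) : bilinear_for *:%R *:%R (fun (u : U) (v : V) => u ⊗ (v ⊗ z)).
  split=> [y|y] a s t /=; first exact: (tl (y ⊗ z)).
  by rewrite -[RHS]tr; congr (y ⊗ _); exact: (tl' z).
rewrite /tassoc tlift_tens ?tlift_tens //; split=> [z|x] a s t /=.
  exact: tlift_linear.
apply: tlift_linear_param => y z.
by rewrite -[RHS]tr; congr (y ⊗ _); exact: tr'.
Qed.

Lemma tmul_tens (K : fieldType) (A : algType K) (a b c d : A) :
  tmul (a ⊗ b) (c ⊗ d) = (a * c) ⊗ (b * d).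
Proof.
have [tl tr] := @tens_bilinear K A A.
have bil x y : bilinear_for *:%R *:%R (fun c d : A => (x * c) ⊗ (y * d)).
  by split=> [z|z] k s t /=; rewrite mulrDr -scalerAr;
    [exact: (tl (_ * _)) | exact: tr].
rewrite /tmul tlift_tens ?tlift_tens //; split=> [z|z] k s t /=;
  apply: tlift_linear_param => x y; rewrite mulrDl -scalerAl;
  [exact: (tl (_ * _)) | exact: tr].
Qed.

HB.mixin Record Lmodule_isCoalgebra (K : fieldType) C of GRing.Lmodule K C := {
  comul : {linear C -> tensor C C};
  counit : {scalar C};
  comulA : forall x : C,
    tassoc (tmap comul id (comul x)) = tmap id comul (comul x);
  counitl : forall x : C, tlift (fun a b => counit a *: b) (comul x) = x;
  counitr : forall x : C, tlift (fun a b => counit b *: a) (comul x) = x;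
}.

#[short(type="coalgType")]
HB.structure Definition Coalgebra (K : fieldType) :=
  {C of Lmodule_isCoalgebra K C & GRing.Lmodule K C}.

HB.mixin Record isBialgebra (K : fieldType) B
    of GRing.Algebra K B & Coalgebra K B := {
  comul1 : comul (1 : B) = 1 ⊗ 1;
  comulM : forall x y : B, comul (x * y) = tmul (comul x) (comul y);
  counit1 : counit (1 : B) = 1;
  counitM : forall x y : B, counit (x * y) = counit x * counit y;
}.

#[short(type="bialgType")]
HB.structure Definition Bialgebra (K : fieldType) :=
  {B of isBialgebra K B & GRing.Algebra K B & Coalgebra K B}.

HB.mixin Record hasAntipode (K : fieldType) H of Bialgebra K H := {
  antipode : {linear H -> H};
  antipodel : forall x : H,
    tlift (fun a b => antipode a * b) (comul x) = (counit x)%:A;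
  antipoder : forall x : H,
    tlift (fun a b => a * antipode b) (comul x) = (counit x)%:A;
}.

#[short(type="hopfAlgType")]
HB.structure Definition HopfAlgebra (K : fieldType) :=
  {H of hasAntipode K H & Bialgebra K H}.

Definition hopf_automorphism (K : fieldType) (H : hopfAlgType K)
    (sigma : {lrmorphism H -> H}) : Prop :=
  [/\ bijective sigma,
      forall x, comul (sigma x) = tmap sigma sigma (comul x),
      forall x, counit (sigma x) = counit x
    & forall x, antipode (sigma x) = sigma (antipode x)].

Definition antipode_sqr (K : fieldType) (H : hopfAlgType K) (x : H) : H :=
  antipode (antipode x).

Definition almost_involutive (K : fieldType) (H : hopfAlgType K) : Prop :=
  exists2 sigma : {lrmorphism H -> H},
    hopf_automorphism sigma & forall x, sigma (sigma x) = antipode_sqr x.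

Definition has_order (T : Type) (f : T -> T) (m : nat) : Prop :=
  [/\ (0 < m)%N, iter m f =1 id
    & forall k, (0 < k < m)%N -> ~ (iter k f =1 id)].

(* Main.v *)
Require Import Defs.
From HB Require Import structures.
From mathcomp Require Import all_boot all_order all_algebra.

Set Implicit Arguments.
Unset Strict Implicit.
Unset Printing Implicit Defensive.

Import GRing.Theory.
Local Open Scope ring_scope.

(** If [S^2] has odd order [m = 2k + 1], then [sigma = (S^2)^(k + 1)] satisfies
    [sigma^2 = (S^2)^(m + 1) = S^2].  It remains to see that [S^2], hence each
    of its powers, is a Hopf algebra endomorphism; it is then bijective because
    a positive power of it is the identity.  This follows from the classical
    fact that the antipode reverses products ([antipodeM]) and coproducts
    ([sw_antipode]), preserves [1] and the counit, so that its square preserves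
    products and coproducts.

    Both reversal laws come from computations in Sweedler's notation, where the
    sum of the [f x1 x2] is [tlift f (comul x)].  In the first one,
      [S(x y) = S(x1 y) x2 S(x3) = S(y) S(x)],
    the last step being [S(x1 y) x2 = eps(x) S(y)], which itself comes from
      [S(x1 y) x2 = S(x1 y1) x2 y2 S(y3) = eps(x) eps(y1) S(y2)].
    The second one is dual: with [f] an arbitrary bilinear map,
    [f(S(x1)_1 x2, S(x1)_2) = f(1, S(x))], and so
    [f(S(x)_1, S(x)_2) = f(S(x1)_1 x2 S(x3), S(x1)_2) = f(S(x2), S(x1))].
    Testing coproducts against all bilinear maps [f], including [tens], makes
    the law for [S] compose with itself at once and needs no algebra structure
    on the tensor square. *)

(** * Sweedler sums *)

Reserved Notation "\sw_ ( a , b <- x ) E"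
  (at level 41, E at level 41, a name, b name, x at level 50,
   format "\sw_ ( a ,  b  <-  x )  E").
Local Notation "\sw_ ( a , b <- x ) E" :=
  (tlift (fun a b => E) (comul x)) : ring_scope.

Local Notation bilin f := (bilinear_for *:%R *:%R f).

Section Linearity.
Variables (K : fieldType).
Implicit Types (U V W X Y : lmodType K) (A : algType K) (C : coalgType K).

Lemma linear0_fun U V (f : U -> V) : linear f -> f 0 = 0.
Proof.
by move=> fl; have := fl (-1) 0 0; rewrite !scaleN1r oppr0 addr0 addNr.
Qed.

Lemma linearZ_fun U V (f : U -> V) a u : linear f -> f (a *: u) = a *: f u.
Proof. by move=> fl; have := fl a u 0; rewrite addr0 (linear0_fun fl) addr0. Qed.

Lemma linear_idfun U : linear (fun x : U => x).
Proof. by []. Qed.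

Lemma linear_appl U V W (h : {linear V -> W}) (g : U -> V) :
  linear g -> linear (fun x => h (g x)).
Proof. by move=> gl a u v; rewrite gl linearP. Qed.

Lemma linear_mull U A (g : U -> A) c :
  linear g -> linear (fun x => g x * c).
Proof. by move=> gl a u v; rewrite gl mulrDl scalerAl. Qed.

Lemma linear_mulr U A (g : U -> A) c :
  linear g -> linear (fun x => c * g x).
Proof. by move=> gl a u v; rewrite gl mulrDr scalerAr. Qed.

Lemma linear_bilinl U V W X (f : V -> W -> X) (g : U -> V) w :
  bilin f -> linear g -> linear (fun x => f (g x) w).
Proof. by move=> [fl _] gl a u v; rewrite gl; exact: (fl w). Qed.

Lemma linear_bilinr U V W X (f : W -> V -> X) (g : U -> V) w :
  bilin f -> linear g -> linear (fun x => f w (g x)).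
Proof. by move=> [_ fr] gl a u v; rewrite gl; exact: (fr w). Qed.

Lemma linear_tensl U V W (g : U -> V) (w : W) :
  linear g -> linear (fun x => g x ⊗ w).
Proof. exact/linear_bilinl/tens_bilinear. Qed.

Lemma linear_tensr U V W (g : U -> V) (w : W) :
  linear g -> linear (fun x => w ⊗ g x).
Proof. exact/linear_bilinr/tens_bilinear. Qed.

Lemma linear_counit U C V (g : U -> C) (h : V) :
  linear g -> linear (fun x => counit (g x) *: h).
Proof. by move=> gl a u v; rewrite gl linearP scalerDl scalerA. Qed.

Lemma linear_scale U V c (g : U -> V) :
  linear g -> linear (fun x => c *: g x).
Proof. by move=> gl a u v; rewrite gl scalerDr !scalerA mulrC. Qed.

Lemma linear_tlift U V W X (f : V -> W -> X) (g : U -> tensor V W) :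
  bilin f -> linear g -> linear (fun x => tlift f (g x)).
Proof. by move=> fb gl a u v; rewrite gl; exact: (tlift_linear fb). Qed.

Lemma linear_tlift_param U V W X (F : U -> V -> W -> X) (t : tensor V W) :
  (forall v w, linear (fun x => F x v w)) -> linear (fun x => tlift (F x) t).
Proof. by move=> Fl a u v; apply: tlift_linear_param => y z; exact: Fl. Qed.

Lemma bilinearI U V W (f : U -> V -> W) :
  (forall v, linear (fun u => f u v)) -> (forall u, linear (f u)) -> bilin f.
Proof. by move=> fl fr; split=> [v|u]; [exact: (fl v) | exact: (fr u)]. Qed.

Lemma eq_tlift U V W (f g : U -> V -> W) (t : tensor U V) :
  (forall u v, f u v = g u v) -> tlift f t = tlift g t.
Proof. by move=> fg; apply: eq_bigr => p _; exact: fg. Qed.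

Lemma tlift_scale U V W c (f : U -> V -> W) (t : tensor U V) :
  tlift (fun u v => c *: f u v) t = c *: tlift f t.
Proof. by rewrite /tlift scaler_sumr. Qed.

(** [tlift] is a finite sum over a representative, so [f] may be any map. *)
Lemma apply_tlift U V W X (g : W -> X) (f : U -> V -> W) (t : tensor U V) :
  linear g -> g (tlift f t) = tlift (fun u v => g (f u v)) t.
Proof.
move=> gl.
have gD x y : g (x + y) = g x + g y by rewrite -[x]scale1r gl !scale1r.
exact: (big_morph g gD (linear0_fun gl)).
Qed.

Lemma exchange_tlift U V W X Y (F : U -> V -> W -> X -> Y)
    (s : tensor U V) (t : tensor W X) :
  tlift (fun a b => tlift (fun c d => F a b c d) t) s =
  tlift (fun c d => tlift (fun a b => F a b c d) s) t.
Proof. exact: exchange_big. Qed.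

Lemma tlift_tens_id U V (t : tensor U V) : tlift (@tens K U V) t = t.
Proof. by rewrite -(@tlift_unique _ _ _ _ (@tens K U V) idfun). Qed.

End Linearity.

(** Proves linearity by structural descent.  The variable occurs once in a
    Sweedler expression, either in the element whose coproduct is taken or in
    the summand, so at most one of the two [tlift] rules applies. *)
Ltac lin :=
  cbv beta; first
  [ assumption
  | exact: linear_idfun
  | apply: linear_tlift_param => ? ?; lin
  | apply: linear_tlift; [apply: bilinearI => ?; lin | lin]
  | apply: linear_tensl; lin
  | apply: linear_tensr; lin
  | apply: linear_counit; lin
  | apply: linear_mull; lin
  | apply: linear_mulr; lin
  | apply: linear_scale; lin
  | apply: linear_appl; lin
  | match goal with h : bilinear_for _ _ _ |- _ =>
      first [apply: (linear_bilinl _ h); lin | apply: (linear_bilinr _ h); lin]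
    end
  | match goal with h : _ |- _ => apply: h
    end ].

Section Sweedler.
Variables (K : fieldType) (C : coalgType K) (W : lmodType K).

(** Coassociativity tested against a trilinear map: apply the linear map
    induced by [T] on the triple tensor product to [comulA]. *)
Lemma sw_assoc (T : C -> C -> C -> W) x :
  (forall b c, linear (fun a => T a b c)) ->
  (forall a c, linear (fun b => T a b c)) ->
  (forall a b, linear (fun c => T a b c)) ->
  \sw_(p, c <- x) \sw_(a, b <- p) T a b c =
  \sw_(a, p <- x) \sw_(b, c <- p) T a b c.
Proof.
move=> T1 T2 T3.
have Tbil a : bilin (T a) by apply: bilinearI => [c|b]; [exact: T2 | exact: T3].
pose phi a y := tlift (T a) y.
have phib : bilin phi.
  apply: bilinearI => [y|a]; first by apply: linear_tlift_param => b c; exact: T1.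
  exact: tlift_linear.
have phil := tlift_linear phib.
have assocb : bilin (fun (y : tensor C C) (c : C) =>
    tlift (fun a b => a ⊗ (b ⊗ c)) y).
  by apply: bilinearI => [c|y]; lin.
have := congr1 (tlift phi) (comulA x).
rewrite /tassoc /tmap (apply_tlift _ _ (tlift_linear assocb)).
rewrite !(apply_tlift _ _ phil) => assocx.
transitivity (\sw_(p, c <- x)
    tlift phi (tlift (fun y c => tlift (fun a b => a ⊗ (b ⊗ c)) y)
                 (comul p ⊗ c))).
  apply: eq_tlift => p c; rewrite (tlift_tens _ _ assocb) (apply_tlift _ _ phil).
  by apply: eq_tlift => a b; rewrite tlift_tens // /phi tlift_tens.
by rewrite assocx; apply: eq_tlift => a p; rewrite tlift_tens.
Qed.

Lemma sw_counitl (f : C -> W) x :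
  linear f -> \sw_(a, b <- x) (counit a *: f b) = f x.
Proof.
move=> fl; rewrite -[in RHS](counitl x) (apply_tlift _ _ fl).
by apply: eq_tlift => a b; rewrite (linearZ_fun _ _ fl).
Qed.

Lemma sw_counitr (f : C -> W) x :
  linear f -> \sw_(a, b <- x) (counit b *: f a) = f x.
Proof.
move=> fl; rewrite -[in RHS](counitr x) (apply_tlift _ _ fl).
by apply: eq_tlift => a b; rewrite (linearZ_fun _ _ fl).
Qed.

End Sweedler.

Section BialgebraSweedler.
Variables (K : fieldType) (B : bialgType K) (W : lmodType K).
Variables (f : B -> B -> W) (fb : bilin f).

Lemma sw_mul x y :
  \sw_(a, b <- x * y) f a b =
  \sw_(a, b <- x) \sw_(c, d <- y) f (a * c) (b * d).
Proof.
have fl := tlift_linear fb.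
rewrite comulM /tmul (apply_tlift _ _ fl); apply: eq_tlift => a b.
by rewrite (apply_tlift _ _ fl); apply: eq_tlift => c d; rewrite tlift_tens.
Qed.

Lemma sw_const k : \sw_(a, b <- k%:A) f a b = k *: f 1 1.
Proof.
rewrite linearZ comul1 (linearZ_fun _ _ (tlift_linear fb)).
by rewrite tlift_tens.
Qed.

End BialgebraSweedler.

(** * The antipode reverses products and coproducts *)

Section Antipode.
Variables (K : fieldType) (H : hopfAlgType K).
Implicit Types (x y : H) (W : lmodType K).
Local Notation S := (@antipode K H).

Lemma antipode1 : S 1 = 1.
Proof.
have := antipodel (1 : H); rewrite counit1 scale1r comul1.
by rewrite tlift_tens ?mulr1 //; apply: bilinearI => ?; lin.
Qed.

(** Apply the counit to [S(x1) x2 = eps(x)]. *)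
Lemma counit_antipode x : counit (S x) = counit x.
Proof.
have counitlin : linear (counit : H -> K^o) by move=> a u v; rewrite linearP.
transitivity (counit ((counit x)%:A : H)); last first.
  by rewrite linearZ /= counit1 mulr1.
have Sl : linear (fun y => (counit (S y) : K^o)) by move=> a u v; rewrite !linearP.
rewrite -antipodel (apply_tlift _ _ counitlin) -(sw_counitr x Sl).
apply: (@eq_tlift K H H K^o) => a b; rewrite counitM mulrC; exact: erefl.
Qed.

(** The antipode axiom at [x y] is [S(x1 y1) x2 y2 = eps(x) eps(y)].  With [y1]
    for [y], multiply it by [S(y2)] on the right and cancel [y2 S(y3)]. *)
Lemma sw_antipode_mul x y :
  \sw_(a, b <- x) (S (a * y) * b) = counit x *: S y.
Proof.
pose T c e d := \sw_(a, b <- x) (S (a * c) * (b * e) * S d).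
(* Both sides are [S(x1 y1) x2 y2 S(y3)]. *)
transitivity (\sw_(c, p <- y) \sw_(e, d <- p) T c e d).
  have Fl : linear (fun c => \sw_(a, b <- x) (S (a * c) * b)) by lin.
  rewrite -(sw_counitr y Fl); apply: eq_tlift => c p.
  rewrite exchange_tlift -tlift_scale; apply: eq_tlift => a b.
  transitivity (S (a * c) * b * (counit p)%:A); first by rewrite -scalerAr mulr1.
  have ml : linear (fun z => S (a * c) * b * z) by lin.
  rewrite -antipoder (apply_tlift _ _ ml).
  by apply: eq_tlift => e d; rewrite !mulrA.
rewrite -(sw_assoc (T := T)); try by move=> *; rewrite /T; lin.
have Sl : linear (fun y => counit x *: S y) by lin.
rewrite -(sw_counitl y Sl); apply: eq_tlift => p d.
rewrite exchange_tlift.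
have fb : bilin (fun a b : H => S a * b * S d) by apply: bilinearI => ?; lin.
rewrite -(sw_mul fb).
have ml : linear (fun z => z * S d) by lin.
rewrite -(apply_tlift _ _ ml) antipodel counitM -scalerAl mul1r.
by rewrite scalerA mulrC.
Qed.

(** Insert [x2 S(x3)] in [S(x1 y)], then apply [sw_antipode_mul]. *)
Lemma antipodeM x y : S (x * y) = S y * S x.
Proof.
pose T a b c := S (a * y) * b * S c.
have Fl : linear (fun a => S (a * y)) by lin.
rewrite -(sw_counitr x Fl).
transitivity (\sw_(a, p <- x) \sw_(b, c <- p) T a b c).
  apply: eq_tlift => a p.
  transitivity (S (a * y) * (counit p)%:A); first by rewrite -scalerAr mulr1.
  have ml : linear (fun z => S (a * y) * z) by lin.
  rewrite -antipoder (apply_tlift _ _ ml).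
  by apply: eq_tlift => b c; rewrite mulrA.
rewrite -(sw_assoc (T := T)); try by move=> *; rewrite /T; lin.
have Sl : linear (fun c => S y * S c) by lin.
rewrite -(sw_counitl x Sl); apply: eq_tlift => p c.
have ml : linear (fun z => z * S c) by lin.
by rewrite -(apply_tlift _ _ ml) sw_antipode_mul scalerAl.
Qed.

(** Dual to [sw_antipode_mul].  The coproduct of [S(x1) x2 = eps(x)] is
    [S(x1)_1 x2 (x) S(x1)_2 x3 = eps(x) 1 (x) 1].  With [x1] for [x], multiply
    the second factor by [S(x2)] on the right and cancel [x3 S(x4)]. *)
Lemma sw_antipode_mull W (f : H -> H -> W) x : bilin f ->
  \sw_(u, q <- x) \sw_(a, b <- S u) f (a * q) b = f 1 (S x).
Proof.
move=> fb; pose T u v z :=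
  \sw_(a, b <- S u) \sw_(c, d <- v) f (a * c) (b * (d * S z)).
(* Both sides are [f(S(x1)_1 x2, S(x1)_2 x3 S(x4))]. *)
transitivity (\sw_(u, q <- x) \sw_(v, z <- q) T u v z).
  apply: eq_tlift => u q; rewrite exchange_tlift; apply: eq_tlift => a b.
  pose R c d z := f (a * c) (b * (d * S z)).
  rewrite (sw_assoc (T := R)); try by move=> *; rewrite /R; lin.
  have Fl : linear (fun q => f (a * q) b) by lin.
  rewrite -(sw_counitr q Fl); apply: eq_tlift => c p.
  have ml : linear (fun z => f (a * c) (b * z)) by lin.
  by rewrite -(apply_tlift _ _ ml) antipoder (linearZ_fun _ _ ml) mulr1.
rewrite -(sw_assoc (T := T)); try by move=> *; rewrite /T; lin.
have Sl : linear (fun z => f 1 (S z)) by lin.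
rewrite -(sw_counitl x Sl); apply: eq_tlift => p z.
pose g a b := f a (b * S z).
have gb : bilin g by apply: bilinearI => ?; rewrite /g; lin.
transitivity (\sw_(u, v <- p) \sw_(a, b <- S u * v) g a b).
  apply: eq_tlift => u v; rewrite (sw_mul gb).
  by apply: eq_tlift => a b; apply: eq_tlift => c d; rewrite /g mulrA.
have gl : linear (fun t => \sw_(a, b <- t) g a b) by lin.
by rewrite -(apply_tlift _ _ gl) antipodel (sw_const gb) /g mul1r.
Qed.

(** Insert [x2 S(x3)] on the right of the first factor of the coproduct of
    [S(x1)], then apply [sw_antipode_mull]. *)
Lemma sw_antipode W (f : H -> H -> W) x : bilin f ->
  \sw_(a, b <- S x) f a b = \sw_(a, b <- x) f (S b) (S a).
Proof.
move=> fb; pose T u q z := \sw_(a, b <- S u) f (a * (q * S z)) b.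
have Fl : linear (fun u => \sw_(a, b <- S u) f a b) by lin.
rewrite -(sw_counitr x Fl).
transitivity (\sw_(u, p <- x) \sw_(q, z <- p) T u q z).
  apply: eq_tlift => u p; rewrite exchange_tlift -tlift_scale.
  apply: eq_tlift => a b.
  have ml : linear (fun z => f (a * z) b) by lin.
  by rewrite -(apply_tlift _ _ ml) antipoder (linearZ_fun _ _ ml) mulr1.
rewrite -(sw_assoc (T := T)); try by move=> *; rewrite /T; lin.
apply: eq_tlift => p z.
have gb : bilin (fun a b => f (a * S z) b) by apply: bilinearI => ?; lin.
have := sw_antipode_mull p gb; rewrite mul1r => <-.
by apply: eq_tlift => u q; apply: eq_tlift => a b; rewrite mulrA.
Qed.

End Antipode.

(** * Powers of the squared antipode *)

Section Powers.
Variables (K : fieldType) (H : hopfAlgType K).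

(** The part of being a Hopf algebra endomorphism that {lrmorphism H -> H} does
    not express.  Commutation with the coproduct is stated against bilinear
    maps, so that it composes by mere substitution. *)
Definition coalgebra_antipode_endomorphism (phi : H -> H) : Prop :=
  [/\ forall (W : lmodType K) (f : H -> H -> W) x, bilin f ->
        \sw_(a, b <- phi x) f a b = \sw_(a, b <- x) f (phi a) (phi b),
      forall x, counit (phi x) = counit x
    & forall x, antipode (phi x) = phi (antipode x)].

Lemma antipode_sqr_coalgebra : coalgebra_antipode_endomorphism (@antipode_sqr K H).
Proof.
split=> // [W f x fb|x]; last by rewrite !counit_antipode.
rewrite (sw_antipode _ fb) sw_antipode //.
by apply: bilinearI => ?; lin.
Qed.

Lemma iter_antipode_sqr n : exists2 sigma : {lrmorphism H -> H},
  sigma =1 iter n (@antipode_sqr K H) & coalgebra_antipode_endomorphism sigma.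
Proof.
have Slin : linear (@antipode_sqr K H).
  by move=> a u v; rewrite /antipode_sqr !linearP.
have Smul : monoid_morphism (@antipode_sqr K H).
  by split=> [|x y]; rewrite /antipode_sqr ?antipode1 // !antipodeM.
pose S2lin := GRing.isLinear.Build K H H *:%R _ Slin.
pose S2mul := GRing.isMonoidMorphism.Build H H _ Smul.
pose S2 : {lrmorphism H -> H} := HB.pack (@antipode_sqr K H) S2lin S2mul.
elim: n => [|n [sigma sigmaE [sigma_sw sigma_counit sigmaS]]].
  by exists idfun.
have [S2_sw S2_counit S2S] := antipode_sqr_coalgebra.
exists (S2 \o sigma) => [x|]; first by rewrite /= sigmaE.
split=> [W f x fb|x|x] /=.
- rewrite (S2_sw _ _ _ fb) sigma_sw //.
  by apply: bilinearI => ?; rewrite /antipode_sqr; lin.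
- by rewrite S2_counit sigma_counit.
- by rewrite S2S sigmaS.
Qed.

End Powers.

Theorem mainTheorem3 (K : closedFieldType) (charK0 : [pchar K] =i pred0)
    (H : hopfAlgType K) (m : nat)
    (order_m : has_order (@antipode_sqr K H) m) (odd_m : odd m) :
  almost_involutive H.
Proof.
have [m_gt0 iter_m _] := order_m.
have [sigma sigmaE [sigma_sw sigma_counit sigmaS]] :=
  iter_antipode_sqr H (m./2).+1.
(* Twice the half of [m] rounded up is [m + 1], as [m] is odd. *)
have sigma2 x : sigma (sigma x) = antipode_sqr x.
  rewrite !sigmaE -iterD addSn addnS addnn.
  have -> : (m./2.*2.+1 = m)%N by rewrite -[RHS]odd_double_half odd_m.
  by rewrite iterS iter_m.
exists sigma => //; split=> // [|x].
- exists (iter m.-1 (@antipode_sqr K H) \o sigma) => x /=; last first.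
    by rewrite !sigmaE -iterD addnC iterD -!sigmaE sigma2 -iterSr prednK.
  by rewrite sigma2 -iterSr prednK.
- rewrite -[LHS]tlift_tens_id sigma_sw //; exact: tens_bilinear.
Qed.
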